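(* Let $G\in\mathcal M_{N,K}$, let $I,J,T\subseteq(0,\infty)$ be open intervals and $\eta>0$. If $G$ is a family-wise critical point with respect to $\{\Phi^{\alpha,\beta,\delta,\eta}\}_{\alpha\in I,\beta\in J,\delta\in T}$ (that is, $\nabla\Phi^{\alpha,\beta,\delta,\eta}(G)=0$ for all $\alpha\in I$, $\beta\in J$, $\delta\in T$) and $$\Phi^{\alpha',\beta',\delta',\eta}(G)<2+(N^2-2)\exp\!\left(\eta\left(\frac{K}{N^2-2}-\frac{K^2}{N(N^2-2)}+\frac{K(N-K)}{N(N-1)(N^2-2)}\right)\right)$$ for some $\alpha',\beta',\delta'\in(0,\infty)$, then $G$ is equidistributed.
   Context: Let $\mathbb F=\mathbb R$ or $\mathbb C$, and let $K,N$ be integers with $1\le K\le N$, $N\ge2$. $\mathcal M_{N,K}=\{G\in\mathbb F^{N\times N}: G=G^2=G^*,\ \mathrm{tr}(G)=K\}$, regarded as a real analytic submanifold of the Hermitian (resp. symmetric) matrices with the Riemannian metric $X\cdot Y=\mathrm{tr}(XY)$; $\nabla$ is the corresponding Riemannian gradient on $\mathcal M_{N,K}$. Indices lie in $\mathbb Z_N$ (so $x+1$ is taken modulo $N$). Open intervals are nonempty. $C_{N,K}=\sqrt{\frac{K(N-K)}{N^2(N-1)}}$. For $G=(G_{a,b})\in\mathcal M_{N,K}$ and $\alpha,\beta,\delta,\eta>0$: - sum potential: $\Phi_{sum}^\eta(G)=\sum_{j\ne l}e^{\eta|G_{j,l}|^2}+\sum_{j=1}^N e^{-\eta(K^2/N^2-C_{N,K}^2)}e^{\eta|G_{j,j}|^2}$;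 - diagonal potential: $\Phi_{diag}^\delta(G)=\frac1\delta\sum_{j=1}^N e^{\delta|G_{j,j}|^2}-\frac N\delta e^{\delta K^2/N^2}$; - exponential row sum potential: $R_x^{\alpha,\beta}(G)=\frac1\alpha\sum_{j\ne x}e^{\alpha|G_{x,j}|^2}+\beta e^{|G_{x,x}|^2}$ for $x\in\mathbb Z_N$; - chain potential: $\Phi_{ch}^{\alpha,\beta}(G)=\sum_{x\in\mathbb Z_N}\left(R_x^{\alpha,\beta}(G)-R_{x+1}^{\alpha,\beta}(G)\right)^2$; - combined potential: $\Phi^{\alpha,\beta,\delta,\eta}(G)=\Phi_{ch}^{\alpha,\beta}(G)+\Phi_{diag}^\delta(G)+\Phi_{sum}^\eta(G)$. $G$ is equidistributed if for each pair $p,q\in\mathbb Z_N$ there exists a permutation $\pi$ of $\mathbb Z_N$ with $|G_{j,p}|=|G_{\pi(j),q}|$ for all $j\in\mathbb Z_N$. *)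

(* Defs.v *)
From HB Require Import structures.
From mathcomp Require Import all_boot all_order all_algebra perm.
From mathcomp Require Import all_classical all_reals all_analysis.
From mathcomp Require Import complex.
Set Implicit Arguments.
Unset Strict Implicit.
Unset Printing Implicit Defensive.
Import Order.TTheory GRing.Theory Num.Theory.
Import numFieldNormedType.Exports.
Local Open Scope classical_set_scope.
Local Open Scope ring_scope.

Inductive base_field := RealField | ComplexField.

Definition scal_field (R : realType) (k : base_field) : fieldType :=
  match k with RealField => R | ComplexField => R[i] end.

Definition scal_re (R : realType) (k : base_field) : scal_field R k -> R :=
  match k return scal_field R k -> R with
  | RealField => fun x => x
  | ComplexField => fun z => complex.Re z
  end.

Definition scal_im (R : realType) (k : base_field) : scal_field R k -> R :=
  match k return scal_field R k -> R with
  | RealField => fun=> 0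
  | ComplexField => fun z => complex.Im z
  end.

Definition scal_conj (R : realType) (k : base_field) :
    scal_field R k -> scal_field R k :=
  match k return scal_field R k -> scal_field R k with
  | RealField => fun x => x
  | ComplexField => fun z => conjc z
  end.

Definition scal_abs (R : realType) (k : base_field) : scal_field R k -> R :=
  match k return scal_field R k -> R with
  | RealField => fun x => `|x|
  | ComplexField => fun z => ComplexField.Normc.normc z
  end.

Section Manifold.
Context {R : realType} {k : base_field} {N : nat}.
Local Notation F := (scal_field R k).
Local Notation M := 'M[F]_N.

Definition adjoint (A : M) : M := map_mx (@scal_conj R k) A^T.

Definition grassmannian (K : nat) : set M :=
  [set G | [/\ G = G *m G, G = adjoint G & \tr G = K%:R]].

(* tr(XY) is real when X and Y are Hermitian; the real part only moves it
   from F to R. *)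
Definition metric (X Y : M) : R := scal_re (\tr (X *m Y)).

(* The derivative is taken with respect to a real parameter, also when
   F = C; hence entrywise, on real and imaginary parts. *)
Definition has_velocity (c : R -> M) (X : M) : Prop :=
  forall i j,
    is_derive (0 : R) 1 (fun t => scal_re (c t i j)) (scal_re (X i j)) /\
    is_derive (0 : R) 1 (fun t => scal_im (c t i j)) (scal_im (X i j)).

(* c is a curve in the Grassmannian through G with initial velocity X.
   Differentiability at 0 is all that is required of c: for a submanifold this
   yields the same tangent vectors as smooth curves. *)
Definition curve_through (K : nat) (G : M) (c : R -> M) (X : M) : Prop :=
  [/\ forall t, grassmannian K (c t), c 0 = G & has_velocity c X].

Definition tangent_vector (K : nat) (G X : M) : Prop :=
  exists c : R -> M, curve_through K G c X.

(* V is the tangent vector at G that represents the differential of Phi on the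
   Grassmannian: dPhi_G(X) = metric V X for all tangent vectors X. *)
Definition is_riemannian_gradient (K : nat) (Phi : M -> R) (G V : M) : Prop :=
  tangent_vector K G V /\
  forall (c : R -> M) (X : M), curve_through K G c X ->
    is_derive (0 : R) 1 (fun t => Phi (c t)) (metric V X).

Definition critical_point (K : nat) (Phi : M -> R) (G : M) : Prop :=
  is_riemannian_gradient K Phi G 0.

Definition familywise_critical_point (K : nat) (Phi : R -> R -> R -> M -> R)
    (I J T : set R) (G : M) : Prop :=
  forall alpha beta delta, I alpha -> J beta -> T delta ->
    critical_point K (Phi alpha beta delta) G.

Definition equidistributed (G : M) : Prop :=
  forall p q : 'I_N, exists s : {perm 'I_N},
    forall j : 'I_N, scal_abs (G j p) = scal_abs (G (s j) q).

End Manifold.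

Definition welch_const (R : realType) (N K : nat) : R :=
  Num.sqrt (K%:R * (N%:R - K%:R) / (N%:R ^+ 2 * (N%:R - 1))).

Section Potentials.
Context {R : realType} {k : base_field} {N : nat}.
Local Notation F := (scal_field R k).
Local Notation M := 'M[F]_N.

Definition sum_potential (K : nat) (eta : R) (G : M) : R :=
  \sum_(j < N) \sum_(l < N | l != j) expR (eta * scal_abs (G j l) ^+ 2) +
  \sum_(j < N)
    expR (- eta * (K%:R ^+ 2 / N%:R ^+ 2 - welch_const R N K ^+ 2)) *
    expR (eta * scal_abs (G j j) ^+ 2).

Definition diag_potential (K : nat) (delta : R) (G : M) : R :=
  delta^-1 * \sum_(j < N) expR (delta * scal_abs (G j j) ^+ 2) -
  N%:R / delta * expR (delta * (K%:R ^+ 2 / N%:R ^+ 2)).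

Definition exp_row_sum (alpha beta : R) (x : 'I_N) (G : M) : R :=
  alpha^-1 * \sum_(j < N | j != x) expR (alpha * scal_abs (G x j) ^+ 2) +
  beta * expR (scal_abs (G x x) ^+ 2).

(* [ordS x] is x + 1 modulo N. *)
Definition chain_potential (alpha beta : R) (G : M) : R :=
  \sum_(x < N)
    (exp_row_sum alpha beta x G - exp_row_sum alpha beta (ordS x) G) ^+ 2.

Definition combined_potential (K : nat) (eta alpha beta delta : R) (G : M) : R :=
  chain_potential alpha beta G + diag_potential K delta G +
  sum_potential K eta G.

End Potentials.

Definition open_interval (R : realType) (I : set R) : Prop :=
  [/\ open I, is_interval I & I !=set0].

(* Main.v *)
Require Import Defs.
From mathcomp Require Import all_boot all_order all_algebra perm.
From mathcomp Require Import all_classical all_reals all_analysis.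
From mathcomp Require Import complex ring lra.
Set Implicit Arguments.
Unset Strict Implicit.
Unset Printing Implicit Defensive.
Import Order.TTheory GRing.Theory Num.Theory.
Import numFieldNormedType.Exports.
Local Open Scope classical_set_scope.
Local Open Scope ring_scope.

(** Write [u_j] for the diagonal entries of [G] and [a_(j,l)] for [|G_(j,l)|^2].

    No off-diagonal entry vanishes.  The chain and diagonal potentials are
    nonnegative, so the upper bound on the combined potential is one on the sum
    potential.  If [G_(p,q) = 0] with [p != q], then also [G_(q,p) = 0]; these
    two entries contribute [2] to the sum potential, and Jensen's inequality for
    the other [N^2 - 2] terms, whose exponents have a sum fixed by
    [\sum a_(j,l) = K], gives exactly the forbidden lower bound
    ([sum_potential_ge]).

    Test curves.  For [p != q] with [G_(p,q) != 0], conjugating [G] by the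
    rotations of the plane of [e_p] and [e_q], with the phase of [G_(p,q)] as
    complex parameter, gives a curve in the Grassmannian along which [u_p] and
    [u_q] move with opposite nonzero speeds [+-2 |G_(p,q)|], while the other
    [u_j] do not move at first order ([exists_diag_transfer_curve]).  These are
    the only curves that the proof uses.

    The diagonal is constant.  Along a test curve only the rate of the diagonal
    potential depends on [delta], so two values of [delta] give
    [u_p (exp (d2 u_p^2) - exp (d1 u_p^2)) = u_q (exp (d2 u_q^2) - exp (d1 u_q^2))].
    Both sides are the value of one strictly increasing function, hence
    [u_p = u_q] ([diag_re_eq]).

    The row sums agree.  With constant diagonal, the differences of consecutive
    row sums do not involve [beta], so the rate of the chain potential is affine
    in [beta], and two values of [beta] show that its slope vanishes.  The slope
    is a linear functional of the speeds of the diagonal, namely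
    [b |-> \sum_x (S_x - S_(x+1)) (b_x - b_(x+1))] up to a nonzero factor.  It
    vanishes on all differences of basis vectors by the test curves and on
    constants for trivial reasons, hence everywhere; at [b = S] it is
    [\sum_x (S_x - S_(x+1))^2], so all [S_x] are equal ([cyclic_gap_eq0],
    [row_exp_sums_eq]).

    Permutations.  For every [alpha] in an open interval the sums
    [\sum_j exp (alpha a_(p,j))] and [\sum_j exp (alpha a_(q,j))] are equal, and
    such a family of exponential sums determines the multiset of exponents
    ([exp_sums_perm]). *)

(** * The scalar field over the reals *)

Section Scalars.
Context {R : realType} {k : base_field}.
Local Notation F := (scal_field R k).
Implicit Types (x y : F) (a : R).

Definition scal_of_real : R -> F :=
  match k return R -> scal_field R k with
  | RealField => fun a => a
  | ComplexField => fun a => a%:C%C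
  end.

Lemma scal_conjD x y : scal_conj (x + y) = scal_conj x + scal_conj y.
Proof. by move: x y; case: k => //= x y; rewrite rmorphD. Qed.
Lemma scal_conjN x : scal_conj (- x) = - scal_conj x.
Proof. by move: x; case: k => //= x; rewrite rmorphN. Qed.
Lemma scal_conjM x y : scal_conj (x * y) = scal_conj x * scal_conj y.
Proof. by move: x y; case: k => //= x y; rewrite rmorphM. Qed.
Lemma scal_conj0 : scal_conj (0 : F) = 0.
Proof. by case: k => //; exact: conjc0. Qed.
Lemma scal_conj1 : scal_conj (1 : F) = 1.
Proof. by case: k => //; exact: conjc1. Qed.
Lemma scal_conj_sum (I : finType) (f : I -> F) :
  scal_conj (\sum_i f i) = \sum_i scal_conj (f i).
Proof. exact: (big_morph _ scal_conjD scal_conj0). Qed.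
Lemma scal_conj_nat (n : nat) : scal_conj (n%:R : F) = n%:R.
Proof.
by elim: n => [|n IH]; rewrite ?scal_conj0 // -natr1 scal_conjD IH scal_conj1.
Qed.
Lemma scal_conj_real a : scal_conj (scal_of_real a) = scal_of_real a.
Proof. by rewrite /scal_of_real; case: k => //=; rewrite oppr0. Qed.

Lemma scal_re_conj x : scal_re (scal_conj x) = scal_re x.
Proof. by move: x; case: k => //= -[]. Qed.
Lemma scal_im_conj x : scal_im (scal_conj x) = - scal_im x.
Proof. by move: x; case: k => //= [_|[]//]; rewrite oppr0. Qed.

Lemma scal_reD x y : scal_re (x + y) = scal_re x + scal_re y.
Proof. by move: x y; case: k => //= -[? ?] []. Qed.
Lemma scal_reN x : scal_re (- x) = - scal_re x.
Proof. by move: x; case: k => //= -[]. Qed.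
Lemma scal_imD x y : scal_im (x + y) = scal_im x + scal_im y.
Proof. by move: x y; case: k => //= [_ _|[? ?] []//]; rewrite addr0. Qed.
Lemma scal_re0 : scal_re (0 : F) = 0. Proof. by case: k. Qed.
Lemma scal_im0 : scal_im (0 : F) = 0. Proof. by case: k. Qed.
Lemma scal_re_sum (I : finType) (f : I -> F) :
  scal_re (\sum_i f i) = \sum_i scal_re (f i).
Proof. exact: (big_morph _ scal_reD scal_re0). Qed.
Lemma scal_im_sum (I : finType) (f : I -> F) :
  scal_im (\sum_i f i) = \sum_i scal_im (f i).
Proof. exact: (big_morph _ scal_imD scal_im0). Qed.
Lemma scal_reM x y :
  scal_re (x * y) = scal_re x * scal_re y - scal_im x * scal_im y.
Proof. by move: x y; case: k => //= [? ?|[? ?] []//]; rewrite mulr0 subr0. Qed.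
Lemma scal_imM x y :
  scal_im (x * y) = scal_re x * scal_im y + scal_im x * scal_re y.
Proof. by move: x y; case: k => //= [? ?|[? ?] []//]; rewrite mulr0 mul0r addr0. Qed.
Lemma scal_re_real a : scal_re (scal_of_real a : F) = a.
Proof. by rewrite /scal_of_real; case: k. Qed.
Lemma scal_im_real a : scal_im (scal_of_real a : F) = 0.
Proof. by rewrite /scal_of_real; case: k. Qed.
Lemma scal_of_realD a b : scal_of_real (a + b) = scal_of_real a + scal_of_real b.
Proof. by rewrite /scal_of_real; case: k => //=; rewrite rmorphD. Qed.
Lemma scal_of_realM a b : scal_of_real (a * b) = scal_of_real a * scal_of_real b.
Proof. by rewrite /scal_of_real; case: k => //=; rewrite rmorphM. Qed.
Lemma scal_of_realN a : scal_of_real (- a) = - scal_of_real a.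
Proof. by rewrite /scal_of_real; case: k => //=; rewrite rmorphN. Qed.
Lemma scal_of_real1 : scal_of_real 1 = 1 :> F.
Proof. by rewrite /scal_of_real; case: k. Qed.
Lemma scal_of_real0 : scal_of_real 0 = 0 :> F.
Proof. by rewrite /scal_of_real; case: k. Qed.

Lemma scal_abs_ge0 x : 0 <= scal_abs x.
Proof. by move: x; case: k => [x|[? ?]] /=; [exact: normr_ge0 | exact: sqrtr_ge0]. Qed.
Lemma scal_abs_eq0 x : scal_abs x = 0 -> x = 0.
Proof.
move: x; case: k => [x|x] /=; first exact: normr0_eq0.
exact: ComplexField.Normc.eq0_normc.
Qed.
Lemma sqr_scal_abs x : scal_abs x ^+ 2 = scal_re x ^+ 2 + scal_im x ^+ 2.
Proof.
move: x; case: k => [x|[a b]] /=.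
  by rewrite expr0n addr0 real_normK // num_real.
by rewrite sqr_sqrtr // addr_ge0 // sqr_ge0.
Qed.
Lemma mulr_scal_conj x : x * scal_conj x = scal_of_real (scal_abs x ^+ 2).
Proof.
rewrite sqr_scal_abs /scal_of_real; move: x; case: k => [x|[a b]] /=.
  by rewrite expr0n addr0.
by apply/eqP; rewrite eq_complex /=; apply/andP; split; apply/eqP; ring.
Qed.
Lemma scal_abs_conj x : scal_abs (scal_conj x) = scal_abs x.
Proof.
apply/eqP; rewrite -(eqrXn2 (_ : 0 < 2)%N) ?scal_abs_ge0 // !sqr_scal_abs.
by rewrite scal_re_conj scal_im_conj sqrrN.
Qed.
End Scalars.

(** * Derivatives of real functions and of curves of matrices *)

Section RealDerivatives.
Context {R : realType}.
Implicit Types (f g : R -> R) (x a df dg : R).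

Lemma is_derive_bigsum (I : Type) (r : seq I) (P : pred I) (f : I -> R -> R)
    (df : I -> R) x :
  (forall i, P i -> is_derive x 1 (f i) (df i)) ->
  is_derive x 1 (fun t => \sum_(i <- r | P i) f i t) (\sum_(i <- r | P i) df i).
Proof.
move=> H; elim: r => [|i r IH].
  have -> : (fun t => \sum_(i <- [::] | P i) f i t) = cst (0 : R).
    by apply/funext => t; rewrite big_nil.
  by rewrite big_nil; exact: is_derive_cst.
have [Pi|nPi] := boolP (P i).
  have -> : (fun t => \sum_(j <- i :: r | P j) f j t) =
            f i \+ (fun t => \sum_(j <- r | P j) f j t).
    by apply/funext => t; rewrite big_cons Pi.
  by rewrite big_cons Pi; apply: is_deriveD => //; exact: H.
have -> : (fun t => \sum_(j <- i :: r | P j) f j t) =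
          (fun t => \sum_(j <- r | P j) f j t).
  by apply/funext => t; rewrite big_cons (negbTE nPi).
by rewrite big_cons (negbTE nPi).
Qed.

Lemma is_derive_add f g x df dg : is_derive x 1 f df -> is_derive x 1 g dg ->
  is_derive x 1 (fun t => f t + g t) (df + dg).
Proof. by move=> Hf Hg; exact: is_deriveD. Qed.

Lemma is_derive_sub f g x df dg : is_derive x 1 f df -> is_derive x 1 g dg ->
  is_derive x 1 (fun t => f t - g t) (df - dg).
Proof. by move=> Hf Hg; exact: is_deriveB. Qed.

Lemma is_derive_mul f g x df dg : is_derive x 1 f df -> is_derive x 1 g dg ->
  is_derive x 1 (fun t => f t * g t) (df * g x + f x * dg).
Proof.
move=> Hf Hg; have := is_deriveM Hf Hg; rewrite /GRing.scale /= => H.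
by apply: (is_derive_eq H); rewrite addrC [g x * _]mulrC.
Qed.

Lemma is_derive_const_mul f x a df : is_derive x 1 f df ->
  is_derive x 1 (fun t => a * f t) (a * df).
Proof. by move=> Hf; exact: is_deriveZ. Qed.

Lemma is_derive_sqr f x df : is_derive x 1 f df ->
  is_derive x 1 (fun t => f t ^+ 2) (2 * f x * df).
Proof.
move=> Hf; have := is_derive_mul Hf Hf => H.
by apply: (is_derive_eq H); ring.
Qed.

Lemma is_derive_expR_mul f x a df : is_derive x 1 f df ->
  is_derive x 1 (fun t => expR (a * f t)) (a * df * expR (a * f x)).
Proof.
move=> Hf; rewrite [_ * expR _]mulrC.
have Hg := is_derive_const_mul a Hf.
have H := @is_derive1_comp R expR (fun t => a * f t) x _ _ (is_derive_expR _) Hg.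
exact: H.
Qed.
End RealDerivatives.

Section Velocities.
Context {R : realType} {k : base_field}.
Local Notation F := (scal_field R k).

(** The entrywise content of [has_velocity]: a derivative at [0] for the real
    parameter, split into real and imaginary parts. *)
Definition has_scal_velocity (f : R -> F) (x : F) : Prop :=
  is_derive (0 : R) 1 (fun t => scal_re (f t)) (scal_re x) /\
  is_derive (0 : R) 1 (fun t => scal_im (f t)) (scal_im x).

Lemma scal_velocity_cst (x : F) : has_scal_velocity (fun=> x) 0.
Proof. by split; rewrite ?scal_re0 ?scal_im0; exact: is_derive_cst. Qed.

Lemma scal_velocity_real (f : R -> R) (df : R) : is_derive (0 : R) 1 f df ->
  has_scal_velocity (fun t => scal_of_real (f t)) (scal_of_real df).
Proof.
move=> H; rewrite /has_scal_velocity scal_re_real scal_im_real; split.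
  by under eq_fun do rewrite scal_re_real.
by under eq_fun do rewrite scal_im_real; exact: is_derive_cst.
Qed.

Lemma scal_velocityD (f g : R -> F) x y :
  has_scal_velocity f x -> has_scal_velocity g y ->
  has_scal_velocity (fun t => f t + g t) (x + y).
Proof.
move=> [f1 f2] [g1 g2]; rewrite /has_scal_velocity scal_reD scal_imD.
by split; [under eq_fun do rewrite scal_reD | under eq_fun do rewrite scal_imD];
  exact: is_deriveD.
Qed.

Lemma scal_velocityM (f g : R -> F) x y :
  has_scal_velocity f x -> has_scal_velocity g y ->
  has_scal_velocity (fun t => f t * g t) (x * g 0 + f 0 * y).
Proof.
move=> [f1 f2] [g1 g2]; split.
  under eq_fun do rewrite scal_reM.
  have H := is_derive_sub (is_derive_mul f1 g1) (is_derive_mul f2 g2).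
apply: (is_derive_eq H).
  by rewrite scal_reD !scal_reM; ring.
under eq_fun do rewrite scal_imM.
have H := is_derive_add (is_derive_mul f1 g2) (is_derive_mul f2 g1).
apply: (is_derive_eq H).
by rewrite scal_imD !scal_imM; ring.
Qed.

Lemma scal_velocity_sum (I : finType) (f : I -> R -> F) x :
  (forall i, has_scal_velocity (f i) (x i)) ->
  has_scal_velocity (fun t => \sum_i f i t) (\sum_i x i).
Proof.
move=> H; rewrite /has_scal_velocity scal_re_sum scal_im_sum.
split; [under eq_fun do rewrite scal_re_sum | under eq_fun do rewrite scal_im_sum].
  by apply: is_derive_bigsum => i _; case: (H i).
by apply: is_derive_bigsum => i _; case: (H i).
Qed.

Context {N : nat}.
Local Notation M := 'M[F]_N.

Lemma velocityM (c d : R -> M) (X Y : M) : has_velocity c X -> has_velocity d Y ->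
  has_velocity (fun t => c t *m d t) (X *m d 0 + c 0 *m Y).
Proof.
move=> hc hd i j.
have H : has_scal_velocity (fun t => \sum_l c t i l * d t l j)
    (\sum_l (X i l * d 0 l j + c 0 i l * Y l j)).
  by apply: scal_velocity_sum => l; apply: scal_velocityM; [exact: hc|exact: hd].
move: H; rewrite big_split /= => H.
rewrite !mxE.
by split; [case: H => + _ | case: H => _ +]; under [in X in _ -> X]eq_fun do rewrite mxE.
Qed.

Lemma sqr_abs_velocity (f : R -> F) x : has_scal_velocity f x ->
  is_derive (0 : R) 1 (fun t => scal_abs (f t) ^+ 2)
    (2 * (scal_re (f 0) * scal_re x + scal_im (f 0) * scal_im x)).
Proof.
move=> [h1 h2]; under eq_fun do rewrite sqr_scal_abs.
have H := is_derive_add (is_derive_sqr h1) (is_derive_sqr h2).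
apply: (is_derive_eq H).
by ring.
Qed.
End Velocities.

(** * Curves given by rotations of a coordinate plane *)

Section PlaneRotations.
Context {R : realType} {k : base_field} {N : nat}.
Local Notation F := (scal_field R k).
Local Notation M := 'M[F]_N.
Implicit Types (A B G : M) (p q i j : 'I_N).

Lemma adjointE A i j : adjoint A i j = scal_conj (A j i).
Proof. by rewrite !mxE. Qed.

Lemma adjointM A B : adjoint (A *m B) = adjoint B *m adjoint A.
Proof.
apply/matrixP => i j; rewrite !mxE scal_conj_sum.
by apply: eq_bigr => l _; rewrite !mxE scal_conjM mulrC.
Qed.

Lemma adjointK : involutive (@adjoint R k N).
Proof.
move=> A; apply/matrixP => i j; rewrite !mxE.
by move: (A i j); case: k => //= x; rewrite conjcK.
Qed.

Lemma velocity_adjoint (c : R -> M) X : has_velocity c X ->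
  has_velocity (fun t => adjoint (c t)) (adjoint X).
Proof.
move=> hc i j; have [h1 h2] := hc j i; rewrite adjointE scal_re_conj scal_im_conj.
split; first by under eq_fun do rewrite adjointE scal_re_conj.
by under eq_fun do rewrite adjointE scal_im_conj; exact: is_deriveN.
Qed.

Lemma conjugate_grassmannian (K : nat) (U G : M) : U *m adjoint U = 1%:M ->
  grassmannian K G -> grassmannian K (U *m G *m adjoint U).
Proof.
move=> UU [idG hermG trG]; have U'U := mulmx1C UU.
split.
- by rewrite !mulmxA -[U *m G *m adjoint U *m U]mulmxA U'U mulmx1 -[U *m G *m G]mulmxA -idG.
- by rewrite !adjointM adjointK -hermG mulmxA.
- by rewrite mxtrace_mulC mulmxA U'U mul1mx.
Qed.

Lemma delta_mulE p q G i j : (delta_mx p q *m G) i j = (i == p)%:R * G q j.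
Proof.
rewrite !mxE (bigD1 q) //= !mxE eqxx andbT big1 ?addr0 // => l /negbTE lq.
by rewrite !mxE lq andbF mul0r.
Qed.

Lemma mul_deltaE p q G i j : (G *m delta_mx p q) i j = G i p * (j == q)%:R.
Proof.
rewrite !mxE (bigD1 p) //= !mxE eqxx /= big1 ?addr0 // => l /negbTE lp.
by rewrite !mxE lp mulr0.
Qed.

Definition plane_proj p q : M := delta_mx p p + delta_mx q q.
(** For [|z| = 1] this skew-Hermitian matrix squares to [- plane_proj p q], so
    that its exponential is given by a cosine and a sine: it is [plane_rot]. *)
Definition plane_gen (z : F) p q : M :=
  z *: delta_mx p q - scal_conj z *: delta_mx q p.
Definition plane_rot (z : F) p q (t : R) : M :=
  1%:M + scal_of_real (cos t - 1) *: plane_proj p q +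
  scal_of_real (sin t) *: plane_gen z p q.

Lemma plane_rot0 z p q : plane_rot z p q 0 = 1%:M.
Proof. by rewrite /plane_rot cos0 sin0 subrr scal_of_real0 !scale0r !addr0. Qed.

Lemma adjoint_plane_gen z p q : adjoint (plane_gen z p q) = - plane_gen z p q.
Proof.
apply/matrixP => i j; rewrite !mxE scal_conjD scal_conjN !scal_conjM !scal_conj_nat.
rewrite (_ : scal_conj (scal_conj z) = z); last first.
  by have /matrixP/(_ i i) := adjointK (const_mx z); rewrite !mxE.
by rewrite opprB [(j == p) && _]andbC [(j == q) && _]andbC.
Qed.

Lemma adjoint_plane_rot z p q t : adjoint (plane_rot z p q t) = plane_rot z p q (- t).
Proof.
rewrite /plane_rot cosN sinN scal_of_realN.
move: (plane_gen z p q) (adjoint_plane_gen z p q) => A hA.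
apply/matrixP => i j; have /matrixP/(_ i j) := hA; rewrite adjointE !mxE => hAij.
rewrite !scal_conjD !scal_conjM !scal_conj_real hAij !scal_conjD !scal_conj_nat.
by rewrite mulrN mulNr eq_sym [(j == p) && _]andbC [(j == q) && _]andbC.
Qed.

Lemma plane_rotN_mul z p q t : p != q -> z * scal_conj z = 1 ->
  plane_rot z p q t *m plane_rot z p q (- t) = 1%:M.
Proof.
move=> pq zz; have qp : q != p by rewrite eq_sym.
have dd (a b c d : 'I_N) :
    delta_mx a b *m delta_mx c d = ((b == c)%:R : F) *: delta_mx a d.
  by rewrite mul_delta_mx_cond scaler_nat.
set P := plane_proj p q; set A := plane_gen z p q.
have PP : P *m P = P.
  rewrite /P /plane_proj mulmxDl !mulmxDr !dd !eqxx (negbTE pq) (negbTE qp).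
  by rewrite !scale1r !scale0r addr0 add0r.
have PA : P *m A = A.
  rewrite /P /A /plane_proj /plane_gen mulmxDl !mulmxBr -!scalemxAr !dd !eqxx.
  by rewrite (negbTE pq) (negbTE qp) !scale1r !scale0r !scaler0 subr0 sub0r.
have AP : A *m P = A.
  rewrite /P /A /plane_proj /plane_gen mulmxDr !mulmxBl -!scalemxAl !dd !eqxx.
  by rewrite (negbTE pq) (negbTE qp) !scale1r !scale0r !scaler0 subr0 sub0r addrC.
have AA : A *m A = - P.
  rewrite /P /A /plane_proj /plane_gen mulmxBr !mulmxBl -!scalemxAl -!scalemxAr !dd !eqxx.
  rewrite (negbTE pq) (negbTE qp) !scale1r !scale0r !scaler0 !scalerA mulrC zz.
  by rewrite !scale1r sub0r subr0 -opprD addrC.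
rewrite /plane_rot cosN sinN scal_of_realN -/P -/A.
have hcs : 2%:R * (scal_of_real (cos t - 1) : F) + scal_of_real (cos t - 1) ^+ 2 +
    scal_of_real (sin t) ^+ 2 = 0.
  rewrite !expr2 -!scal_of_realM mulr_natl mulr2n -!scal_of_realD -(@scal_of_real0 R k).
  congr scal_of_real; have := cos2Dsin2 t; rewrite !expr2 => h; lra.
move: hcs; set a := scal_of_real (cos t - 1); set b := scal_of_real (sin t) => hcs.
rewrite !mulmxDl !mulmxDr !mul1mx !mulmx1 -!scalemxAl -!scalemxAr PP PA AP AA.
transitivity (1%:M + (2%:R * a + a ^+ 2 + b ^+ 2) *: P); last first.
  by rewrite hcs scale0r addr0.
clearbody P A a b; apply/matrixP => i j; rewrite !mxE. ring.
Qed.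

Lemma velocity_plane_rot z p q : has_velocity (plane_rot z p q) (plane_gen z p q).
Proof.
move=> i j.
have hc : is_derive (0 : R) 1 (fun t => cos t - 1) (- sin (0 : R) - 0).
  have H1 : is_derive (0 : R) 1 (fun=> 1 : R) (0 : R) by exact: is_derive_cst.
  exact: (is_derive_sub (is_derive_cos (0 : R)) H1).
have H := scal_velocityD (scal_velocityD (scal_velocity_cst ((1%:M : M) i j))
  (scal_velocityM (scal_velocity_real hc) (scal_velocity_cst (plane_proj p q i j))))
  (scal_velocityM (scal_velocity_real (is_derive_sin (0 : R)))
     (scal_velocity_cst (plane_gen z p q i j))).
move: H; rewrite sin0 cos0 subr0 oppr0 scal_of_real0 scal_of_real1 !mul0r !mulr0.
rewrite mul1r !addr0 !add0r => -[h1 h2].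
have E t : plane_rot z p q t i j = 1%:M i j +
    scal_of_real (cos t - 1) * plane_proj p q i j +
    scal_of_real (sin t) * plane_gen z p q i j by rewrite !mxE.
by split; under eq_fun do rewrite E.
Qed.

Lemma grassmannian_conj K G i j : grassmannian K G -> scal_conj (G i j) = G j i.
Proof. by move=> [_ h _]; rewrite {2}h adjointE. Qed.

(** The initial velocity is the commutator of [plane_gen z p q] and [G], whose
    diagonal is [+- 2 Re (z G_(q,p))] at [p] and [q] and zero elsewhere.  Taking
    for [z] the phase of [G_(p,q)] makes this real part [|G_(p,q)|], which is not
    zero. *)
Lemma exists_diag_transfer_curve (K : nat) G p q : grassmannian K G -> p != q ->
  G p q != 0 -> exists c X, curve_through K G c X /\
    forall j, scal_re (X j j) = 2 * scal_abs (G p q) * ((j == p)%:R - (j == q)%:R).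
Proof.
move=> hG pq Gpq.
have absG : scal_abs (G p q) != 0.
  by apply: contra_neq Gpq; exact: scal_abs_eq0.
pose z := G p q * scal_of_real (scal_abs (G p q))^-1.
have zG : z * G q p = scal_of_real (scal_abs (G p q)).
  rewrite /z mulrAC -(grassmannian_conj p q hG) mulr_scal_conj -scal_of_realM.
  by rewrite expr2 mulfK.
have zz : z * scal_conj z = 1.
  rewrite {2}/z scal_conjM scal_conj_real (grassmannian_conj _ _ hG) mulrA zG.
  by rewrite -scal_of_realM divff // scal_of_real1.
exists (fun t => plane_rot z p q t *m G *m adjoint (plane_rot z p q t)).
exists (plane_gen z p q *m G + G *m adjoint (plane_gen z p q)); split.
  split.
  - move=> t; apply: conjugate_grassmannian => //.
    by rewrite adjoint_plane_rot; exact: plane_rotN_mul.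
  - by rewrite adjoint_plane_rot oppr0 plane_rot0 mul1mx mulmx1.
  - have H := velocityM (velocityM (@velocity_plane_rot z p q)
      (_ : has_velocity (fun=> G) 0)) (velocity_adjoint (@velocity_plane_rot z p q)).
    have H0 : has_velocity (fun=> G) 0.
      by move=> i j; rewrite mxE; exact: scal_velocity_cst.
    move: (H H0); rewrite /= adjoint_plane_rot oppr0 plane_rot0 mulmx0 addr0.
    by rewrite mulmx1 mul1mx.
have zG' : scal_conj z * G p q = scal_of_real (scal_abs (G p q)).
  have := congr1 (@scal_conj R k) zG.
  by rewrite scal_conjM scal_conj_real (grassmannian_conj _ _ hG).
move=> j; rewrite adjoint_plane_gen mulmxN /plane_gen mulmxBl mulmxBr.
rewrite -!scalemxAl -!scalemxAr.
have -> : (z *: (delta_mx p q *m G) - scal_conj z *: (delta_mx q p *m G) -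
    (z *: (G *m delta_mx p q) - scal_conj z *: (G *m delta_mx q p))) j j =
    z * ((j == p)%:R * G q j) - scal_conj z * ((j == q)%:R * G p j) -
    (z * (G j p * (j == q)%:R) - scal_conj z * (G j q * (j == p)%:R)).
  by rewrite -!delta_mulE -!mul_deltaE; move: (delta_mx p q *m G) => B1;
    move: (delta_mx q p *m G) (G *m delta_mx p q) (G *m delta_mx q p) => B2 B3 B4; rewrite !mxE.
have [->|jp] := eqVneq j p.
  rewrite (negbTE pq) !mul0r !mulr0 mul1r mulr1 subr0 sub0r opprK scal_reD.
  rewrite zG zG' scal_re_real /= ?mulr1n ?mulr0n; ring.
have [->|jq] := eqVneq j q.
  rewrite !mul0r !mulr0 mul1r mulr1 sub0r subr0 zG zG' -opprD scal_reN.
  rewrite scal_reD scal_re_real /= ?mulr1n ?mulr0n; ring.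
by rewrite subrr !mul0r !mulr0 !subr0 scal_re0.
Qed.
End PlaneRotations.

(** * Rates of change of the potentials *)

Section PotentialRates.
Context {R : realType} {k : base_field} {N : nat}.
Local Notation F := (scal_field R k).
Local Notation M := 'M[F]_N.
Implicit Types (G X : M) (c : R -> M) (a b : 'I_N -> 'I_N -> R).

Definition sqr_abs_rate G X (i j : 'I_N) : R :=
  2 * (scal_re (G i j) * scal_re (X i j) + scal_im (G i j) * scal_im (X i j)).

Definition row_sum_rate (alpha beta : R) G X (x : 'I_N) : R :=
  \sum_(j < N | j != x) sqr_abs_rate G X x j * expR (alpha * scal_abs (G x j) ^+ 2) +
  beta * (sqr_abs_rate G X x x * expR (scal_abs (G x x) ^+ 2)).

Definition chain_rate (alpha beta : R) G X : R :=
  \sum_(x < N) 2 * (exp_row_sum alpha beta x G - exp_row_sum alpha beta (ordS x) G) *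
    (row_sum_rate alpha beta G X x - row_sum_rate alpha beta G X (ordS x)).

Definition diag_rate (delta : R) G X : R :=
  \sum_(j < N) sqr_abs_rate G X j j * expR (delta * scal_abs (G j j) ^+ 2).

Definition sum_rate (K : nat) (eta : R) G X : R :=
  \sum_(j < N) \sum_(l < N | l != j)
     eta * sqr_abs_rate G X j l * expR (eta * scal_abs (G j l) ^+ 2) +
  \sum_(j < N) expR (- eta * (K%:R ^+ 2 / N%:R ^+ 2 - welch_const R N K ^+ 2)) *
     (eta * sqr_abs_rate G X j j * expR (eta * scal_abs (G j j) ^+ 2)).

Lemma row_sum_derive (alpha beta : R) c X x : alpha != 0 -> has_velocity c X ->
  is_derive (0 : R) 1 (fun t => exp_row_sum alpha beta x (c t))
    (row_sum_rate alpha beta (c 0) X x).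
Proof.
move=> a0 hc.
have hexp (eta : R) j l := is_derive_expR_mul eta (sqr_abs_velocity (hc j l)).
have h1 := is_derive_const_mul alpha^-1
  (@is_derive_bigsum R _ (index_enum 'I_N) (fun j => j != x) _ _ 0
     (fun j _ => hexp alpha x j)).
have h2 := is_derive_const_mul beta (hexp (1:R) x x).
have H := is_derive_add h1 h2.
rewrite /exp_row_sum.
under eq_fun do rewrite -[scal_abs (_ x x) ^+ 2]mul1r.
apply: (is_derive_eq H); rewrite /row_sum_rate !mul1r; congr (_ + _).
by rewrite mulr_sumr; apply: eq_bigr => j _; rewrite -mulrA mulKf.
Qed.

Lemma combined_potential_derive (K : nat) (eta alpha beta delta : R) c X :
  alpha != 0 -> delta != 0 -> has_velocity c X ->
  is_derive (0 : R) 1 (fun t => combined_potential K eta alpha beta delta (c t))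
    (chain_rate alpha beta (c 0) X + diag_rate delta (c 0) X + sum_rate K eta (c 0) X).
Proof.
move=> a0 d0 hc.
have hexp (e : R) j l := is_derive_expR_mul e (sqr_abs_velocity (hc j l)).
have hrow (x : 'I_N) := row_sum_derive beta x a0 hc.
apply: is_derive_add; first apply: is_derive_add.
- apply: is_derive_bigsum => x _.
  exact: (is_derive_sqr (is_derive_sub (hrow x) (hrow (ordS x)))).
- have h1 := is_derive_const_mul delta^-1 (@is_derive_bigsum R _ (index_enum 'I_N)
    predT _ _ 0 (fun j _ => hexp delta j j)).
  have h2 : is_derive (0 : R) 1
    (fun=> N%:R / delta * expR (delta * (K%:R ^+ 2 / N%:R ^+ 2)) : R) (0 : R).
    exact: is_derive_cst.
  apply: (is_derive_eq (is_derive_sub h1 h2)).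
  by rewrite subr0 mulr_sumr; apply: eq_bigr => j _; rewrite -mulrA mulKf.
- apply: is_derive_add.
    by apply: is_derive_bigsum => j _; apply: is_derive_bigsum => l _; exact: hexp.
  by apply: is_derive_bigsum => j _; apply: is_derive_const_mul; exact: hexp.
Qed.

(** Of the three summands, only [diag_rate] contains [delta] and only
    [chain_rate] contains [beta]; comparing two values of either parameter isolates
    the corresponding summand. *)
Lemma critical_rate (K : nat) (eta alpha beta delta : R) G c X :
  alpha != 0 -> delta != 0 ->
  critical_point K (combined_potential K eta alpha beta delta) G ->
  curve_through K G c X ->
  chain_rate alpha beta G X + diag_rate delta G X + sum_rate K eta G X = 0.
Proof.
move=> a0 d0 [_ /(_ c X) hcrit] hc; have [_ c0 hv] := hc.
have H1 := hcrit hc.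
have H2 := combined_potential_derive K eta beta a0 d0 hv.
have := @derive_val _ _ _ _ _ _ _ H2; rewrite (@derive_val _ _ _ _ _ _ _ H1) c0 => <-.
by rewrite /metric mul0mx mxtrace0 scal_re0.
Qed.
End PotentialRates.

(** * Inequalities, cyclic differences and exponential sums *)

Section RealLemmas.
Context {R : realType}.

(** Summed over a family with mean [m], this is Jensen's inequality for [expR]. *)
Lemma expR_tangent (m t : R) : expR m * (1 + (t - m)) <= expR t.
Proof.
rewrite -{2}(subrK m t) expRD mulrC ler_wpM2r ?expR_ge0 //.
exact: expR_ge1Dx.
Qed.

(** Either side factors as [u exp (d1 u^2) (exp ((d2 - d1) u^2) - 1)], a product
    of nonnegative strictly increasing functions of [u >= 0]. *)
Lemma exp_gap_inj (d1 d2 u v : R) : d1 < d2 -> 0 < d1 -> 0 <= u -> 0 <= v ->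
  u * (expR (d2 * u ^+ 2) - expR (d1 * u ^+ 2)) =
  v * (expR (d2 * v ^+ 2) - expR (d1 * v ^+ 2)) -> u = v.
Proof.
move=> d12 d1p.
have H (x y : R) : 0 <= x -> x < y ->
    x * (expR (d2 * x ^+ 2) - expR (d1 * x ^+ 2)) <
    y * (expR (d2 * y ^+ 2) - expR (d1 * y ^+ 2)).
  move=> x0 xy.
  have E z : expR (d2 * z ^+ 2) - expR (d1 * z ^+ 2) =
      expR (d1 * z ^+ 2) * (expR ((d2 - d1) * z ^+ 2) - 1).
    by rewrite mulrBr mulr1 -expRD; congr (expR _ - _); ring.
  rewrite (E x) (E y).
  have xy2 : x ^+ 2 < y ^+ 2 by rewrite ltr_pXn2r // nnegrE // ltW // (le_lt_trans x0).
  have d21 : 0 < d2 - d1 by rewrite subr_gt0.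
  have g0 z : 0 <= expR ((d2 - d1) * z ^+ 2) - 1.
    by rewrite subr_ge0 -expR0 ler_expR mulr_ge0 ?sqr_ge0 // ltW.
  apply: ltr_pM => //; first exact: mulr_ge0 (expR_ge0 _) (g0 _).
  apply: ltr_pM; rewrite ?expR_ge0 ?g0 //; first by rewrite ltr_expR ltr_pM2l.
  by rewrite ltrD2r ltr_expR ltr_pM2l.
move=> u0 v0 e; case: (ltgtP u v) => // h.
  by have := H _ _ u0 h; rewrite e ltxx.
by have := H _ _ v0 h; rewrite e ltxx.
Qed.

(** The hypothesis says that the functional
    [b |-> \sum_x (S_x - S_(x+1)) (b_x - b_(x+1))] takes the same value on all
    basis vectors.  These values add up to its value on a constant, which is zero,
    so the functional is zero; evaluate it at [S]. *)
Lemma cyclic_gap_eq0 (N : nat) (S : 'I_N -> R) :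
  (forall p q, p != q ->
    \sum_x (S x - S (ordS x)) *
      (((x == p)%:R - (x == q)%:R) - ((ordS x == p)%:R - (ordS x == q)%:R)) = 0) ->
  forall x, S (ordS x) = S x.
Proof.
move=> H.
pose L (b : 'I_N -> R) := \sum_x (S x - S (ordS x)) * (b x - b (ordS x)).
pose d p : 'I_N -> R := fun x => (x == p)%:R.
have Ld p q : L (d p) = L (d q).
  have [->//|pq] := eqVneq p q.
  apply/eqP; rewrite -subr_eq0; apply/eqP; rewrite -{}[RHS](H p q pq).
  by rewrite /L -sumrB; apply: eq_bigr => x _; rewrite /d; ring.
have Lb b : L b = \sum_p b p * L (d p).
  rewrite /L; under [RHS]eq_bigr do rewrite mulr_sumr.
  rewrite exchange_big /=; apply: eq_bigr => x _.
  have E y : b y = \sum_p b p * d p y.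
    rewrite (bigD1 y) //= /d eqxx mulr1 big1 ?addr0 // => p py.
    by rewrite eq_sym (negbTE py) mulr0.
  rewrite {1}(E x) {1}(E (ordS x)) -sumrB mulr_sumr; apply: eq_bigr => p _; ring.
have L1 : L (fun=> 1) = 0 by apply: big1 => x _; rewrite subrr mulr0.
have Ld0 p : L (d p) = 0.
  have : N%:R * L (d p) = 0.
    rewrite -L1 [RHS]Lb (eq_bigr (fun=> L (d p))); last by move=> q _; rewrite mul1r; exact: Ld.
    by rewrite sumr_const card_ord mulr_natl.
  move/eqP; rewrite mulf_eq0 pnatr_eq0 => /orP[/eqP N0|/eqP //].
  by have := ltn_ord p; rewrite [X in (_ < X)%N]N0.
have : L S = 0 by rewrite Lb big1 // => p _; rewrite Ld0 mulr0.
move=> /eqP; rewrite /L psumr_eq0; last by move=> x _; rewrite -expr2 sqr_ge0.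
move=> /allP h x; have := h x (mem_index_enum x).
by rewrite /= mulf_eq0 orbb subr_eq0 => /eqP.
Qed.

Lemma ordS_const (T : Type) (N : nat) (f : 'I_N -> T) :
  (forall x, f (ordS x) = f x) -> forall x y, f x = f y.
Proof.
case: N f => [f _ []//|N f H].
suff H0 n (h : (n < N.+1)%N) : f (Ordinal h) = f ord0.
  by move=> [x hx] [y hy]; rewrite !H0.
elim: n h => [h|n IH h]; first by congr f; apply: val_inj.
rewrite -(IH (ltnW h)) -[RHS]H; congr f; apply: val_inj => /=.
by rewrite modn_small.
Qed.

Lemma open_interval_arith (I : set R) : open_interval I -> forall n : nat,
  exists x h : R, 0 < h /\ forall i, (i <= n)%N -> I (x + i%:R * h).
Proof.
move=> [oI _ [x Ix]] n.
have /nbhs_ballP[e /= e0 be] : nbhs x I by exact: open_nbhs_nbhs.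
exists x, (e / n.+1%:R); split; first by rewrite divr_gt0.
move=> i ile; apply: be; rewrite /ball /= opprD addrA subrr sub0r normrN.
rewrite ger0_norm; last by rewrite mulr_ge0 // divr_ge0 // ltW.
by rewrite mulrCA gtr_pMr // ltr_pdivrMr // mul1r ltr_nat ltnS.
Qed.

Lemma open_interval_pair (I : set R) : open_interval I ->
  exists x y : R, [/\ x < y, I x & I y].
Proof.
move=> /open_interval_arith/(_ 1%N)[x [h [h0 Ix]]]; exists (x + 0%:R * h), (x + 1%:R * h).
by split; [rewrite mul0r addr0 mul1r ltrDl | exact: Ix | exact: Ix].
Qed.

(** At the points [alpha = x + i h] of an arithmetic progression, [exp (alpha y)]
    is [exp (x y)] times the [i]-th power of [exp (h y)].  Taking linear
    combinations over [i], the hypothesis becomes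
    [\sum_j exp (x f_j) P(exp (h f_j)) = \sum_j exp (x g_j) P(exp (h g_j))]
    for all polynomials [P] of degree at most [2 N].  A [P] that vanishes at all
    the [exp (h y)] except the one with [y = v] compares the multiplicities of
    [v]. *)
Lemma exp_sums_perm (N : nat) (f g : 'I_N -> R) (I : set R) : open_interval I ->
  (forall alpha, I alpha -> \sum_j expR (alpha * f j) = \sum_j expR (alpha * g j)) ->
  exists s : {perm 'I_N}, forall j, f j = g (s j).
Proof.
move=> oI H.
have [x [h [h0 Ix]]] := open_interval_arith oI (N + N).
have E i (y : R) : expR ((x + i%:R * h) * y) = expR (x * y) * expR (h * y) ^+ i.
  by rewrite -expRM_natl -expRD; congr expR; ring.
have HP (P : {poly R}) : (size P <= (N + N).+1)%N ->
    \sum_j expR (x * f j) * P.[expR (h * f j)] = \sum_j expR (x * g j) * P.[expR (h * g j)].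
  move=> sP.
  have main (F : 'I_N -> R) : \sum_j expR (x * F j) * P.[expR (h * F j)] =
      \sum_(i < (N + N).+1) P`_i * \sum_j expR ((x + i%:R * h) * F j).
    under eq_bigr => j _ do rewrite (horner_coef_wide _ sP) mulr_sumr.
    rewrite exchange_big /=; apply: eq_bigr => i _; rewrite mulr_sumr.
    by apply: eq_bigr => j _; rewrite E; ring.
  rewrite !main; apply: eq_bigr => i _; congr (_ * _); apply: H.
  by apply: Ix; rewrite -ltnS.
suff pe : perm_eq [tuple f j | j < N] [tuple g j | j < N].
  have /tuple_permP [s hs] := pe; exists s => j.
  have := congr1 (fun t => nth 0 t j) hs.
  by rewrite -!tnth_nth !tnth_mktuple.
apply/allP => v _ /=; apply/eqP.
(* The values other than [v], with repetitions: their number bounds the degree. *)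
pose s := [seq y <- map f (enum 'I_N) ++ map g (enum 'I_N) | y != v].
pose P := \prod_(y <- s) ('X - (expR (h * y))%:P).
have sP : (size P <= (N + N).+1)%N.
  rewrite size_prod_XsubC ltnS size_filter (leq_trans (count_size _ _)) //.
  by rewrite size_cat !size_map -enumT size_enum_ord.
have Pv : P.[expR (h * v)] != 0.
  rewrite horner_prod prodf_seq_neq0; apply/allP => y; rewrite mem_filter => /andP[yv _].
  rewrite /= !hornerE subr_eq0; apply: contra_neq yv => /expR_inj.
  by move/(mulfI (lt0r_neq0 h0)).
have P0 y : y != v -> y \in map f (enum 'I_N) ++ map g (enum 'I_N) -> P.[expR (h * y)] = 0.
  move=> yv ym; apply/eqP; rewrite horner_prod prodf_seq_eq0.
  by apply/hasP; exists y; rewrite ?mem_filter ?yv //= !hornerE subrr.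
have cnt (F : 'I_N -> R) :
    {subset map F (enum 'I_N) <= map f (enum 'I_N) ++ map g (enum 'I_N)} ->
    \sum_j expR (x * F j) * P.[expR (h * F j)] =
    (count_mem v [tuple F j | j < N])%:R * (expR (x * v) * P.[expR (h * v)]).
  move=> sub; rewrite (bigID (fun j => F j == v)) /= [X in _ + X]big1; last first.
    by move=> j jv; rewrite P0 ?mulr0 //; apply: sub; rewrite map_f // mem_enum.
  rewrite addr0 (eq_bigr (fun=> expR (x * v) * P.[expR (h * v)])); last by move=> j /eqP ->.
  rewrite sumr_const mulr_natl; congr (_ *+ _).
  rewrite count_map cardE size_filter /= -enumT.
  by apply: eq_count.
have := HP P sP; rewrite !cnt.
- have w0 : expR (x * v) * P.[expR (h * v)] != 0.
    by rewrite mulf_neq0 // gt_eqF ?expR_gt0.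
  by move/(mulIf w0)/eqP; rewrite eqr_nat => /eqP.
- by move=> y yg; rewrite mem_cat yg orbT.
- by move=> y yf; rewrite mem_cat yf.
Qed.
End RealLemmas.

(** * Entries of a projection and the sum potential *)

Section GrassmannianEntries.
Context {R : realType} {k : base_field} {N K : nat}.
Local Notation F := (scal_field R k).
Variables (G : 'M[F]_N) (hG : grassmannian K G).
Implicit Types (p q i j l : 'I_N).

Lemma abs_sym i j : scal_abs (G i j) = scal_abs (G j i).
Proof. by rewrite -(grassmannian_conj j i hG) scal_abs_conj. Qed.

Lemma im_diag j : scal_im (G j j) = 0.
Proof.
have := congr1 (@scal_im R k) (grassmannian_conj j j hG); rewrite scal_im_conj => h.
lra.
Qed.

Lemma sqr_abs_diag j : scal_abs (G j j) ^+ 2 = scal_re (G j j) ^+ 2.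
Proof. by rewrite sqr_scal_abs im_diag expr0n addr0. Qed.

(** The diagonal of [G = G G^*]. *)
Lemma row_sqr_norm j : \sum_l scal_abs (G j l) ^+ 2 = scal_re (G j j).
Proof.
have [idG _ _] := hG; rewrite {2}idG mxE scal_re_sum; apply: eq_bigr => l _.
by rewrite -(grassmannian_conj j l hG) mulr_scal_conj scal_re_real.
Qed.

Lemma re_diag_ge0 j : 0 <= scal_re (G j j).
Proof. by rewrite -row_sqr_norm sumr_ge0 // => l _; exact: sqr_ge0. Qed.

Lemma sum_re_diag : \sum_j scal_re (G j j) = K%:R.
Proof.
have [_ _ trG] := hG; rewrite -scal_re_sum -[X in scal_re X]/(\tr G) trG.
elim: K => [|n IH]; first exact: scal_re0.
rewrite -natr1 scal_reD IH -[in RHS]natr1; congr (_ + _).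
by rewrite -(scal_of_real1 (R := R) (k := k)) scal_re_real.
Qed.

Lemma sum_sqr_abs : \sum_j \sum_l scal_abs (G j l) ^+ 2 = K%:R.
Proof. by rewrite -sum_re_diag; apply: eq_bigr => j _; exact: row_sqr_norm. Qed.

Lemma chain_potential_ge0 (alpha beta : R) : 0 <= chain_potential alpha beta G.
Proof. by apply: sumr_ge0 => x _; exact: sqr_ge0. Qed.

(** Jensen's inequality, together with [\sum_j u_j^2 >= K^2 / N] for the diagonal
    entries [u_j], whose sum is [K]. *)
Lemma diag_potential_ge0 (delta : R) : (0 < N)%N -> 0 < delta ->
  0 <= diag_potential K delta G.
Proof.
move=> N0 d0; have n0 : 0 < N%:R :> R by rewrite ltr0n.
rewrite /diag_potential [N%:R / delta]mulrC -mulrA -mulrBr.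
rewrite mulr_ge0 ?invr_ge0 ?(ltW d0) // subr_ge0.
set m := delta * _.
apply: (@le_trans _ _ (\sum_j expR m * (1 + (delta * scal_abs (G j j) ^+ 2 - m)))).
  rewrite -mulr_sumr big_split /= sumr_const card_ord sumrB sumr_const card_ord.
  rewrite -mulr_sumr mulrC ler_wpM2l ?expR_ge0 // lerDl subr_ge0.
  rewrite -mulr_natl /m mulrCA ler_pM2l //.
  have : 0 <= \sum_j (scal_re (G j j) - K%:R / N%:R) ^+ 2.
    by apply: sumr_ge0 => j _; exact: sqr_ge0.
  rewrite (eq_bigr (fun j => scal_abs (G j j) ^+ 2 +
     (- (2 * (K%:R / N%:R)) * scal_re (G j j) + (K%:R / N%:R) ^+ 2))); last first.
    by move=> j _; rewrite sqr_abs_diag; ring.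
  rewrite !big_split /= -mulr_sumr sum_re_diag sumr_const card_ord -mulr_natl.
  set s := \sum_j _ => h; rewrite -subr_ge0; apply: le_trans h _.
  rewrite le_eqVlt; apply/orP; left; apply/eqP; field.
  by rewrite gt_eqF.
by apply: ler_sum => j _; exact: expR_tangent.
Qed.

(** The exponent [m] of the bound is the mean of the exponents of the [N^2 - 2]
    terms other than [(p, q)] and [(q, p)]; these two terms are [expR 0]. *)
Lemma sum_potential_ge (eta : R) p q : (2 <= N)%N -> (K <= N)%N -> p != q -> G p q = 0 ->
  2 + (N%:R ^+ 2 - 2) *
    expR (eta * (K%:R / (N%:R ^+ 2 - 2) - K%:R ^+ 2 / (N%:R * (N%:R ^+ 2 - 2))
                + K%:R * (N%:R - K%:R) / (N%:R * (N%:R - 1) * (N%:R ^+ 2 - 2))))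
  <= sum_potential K eta G.
Proof.
move=> N2 KN pq Gpq.
have n2 : 2 <= N%:R :> R by rewrite ler_nat.
have kn : K%:R <= N%:R :> R by rewrite ler_nat.
have k0 : 0 <= K%:R :> R by exact: ler0n.
have C2 : welch_const R N K ^+ 2 = K%:R * (N%:R - K%:R) / (N%:R ^+ 2 * (N%:R - 1)).
  rewrite /welch_const sqr_sqrtr // divr_ge0 ?mulr_ge0 ?exprn_ge0 ?subr_ge0 //.
  by lra.
set m := eta * _.
pose w (x : 'I_N * 'I_N) : R := eta * scal_abs (G x.1 x.2) ^+ 2 -
  (x.2 == x.1)%:R * (eta * (K%:R ^+ 2 / N%:R ^+ 2 - welch_const R N K ^+ 2)).
have -> : sum_potential K eta G = \sum_x expR (w x).
  rewrite -(pair_bigA _ (fun j l => expR (w (j, l)))) /= /sum_potential -big_split /=.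
  apply: eq_bigr => j _; rewrite [RHS](bigD1 j) //= addrC; congr (_ + _).
    by rewrite -expRD /w /= eqxx mul1r; congr expR; ring.
  by apply: eq_bigr => l lj; rewrite /w /= (negbTE lj) mul0r subr0.
(* Here the choice of [welch_const] enters: it makes the mean equal to [m]. *)
have Ew : \sum_x w x = (N%:R ^+ 2 - 2) * m.
  rewrite -(pair_bigA _ (fun j l => w (j, l))) /= /w /=.
  rewrite (eq_bigr (fun j => eta * (\sum_l scal_abs (G j l) ^+ 2) -
    (eta * (K%:R ^+ 2 / N%:R ^+ 2 - welch_const R N K ^+ 2)))); last first.
    move=> j _; rewrite sumrB mulr_sumr; congr (_ - _).
    rewrite (bigD1 j) //= eqxx mul1r big1 ?addr0 // => l lj.
    by rewrite (negbTE lj) mul0r.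
  rewrite sumrB -mulr_sumr sum_sqr_abs sumr_const card_ord -mulr_natl C2 /m.
  field.
  by apply/and3P; split; apply: lt0r_neq0; nra.
have qp : (q, p) != (p, q) by rewrite xpair_eqE negb_and eq_sym pq.
have Gqp : scal_abs (G q p) ^+ 2 = 0.
  by rewrite abs_sym sqr_scal_abs Gpq scal_re0 scal_im0 expr0n addr0.
have wpq : w (p, q) = 0.
  by rewrite /w /= abs_sym Gqp [q == p]eq_sym (negbTE pq) mul0r mulr0 subr0.
have wqp : w (q, p) = 0.
  by rewrite /w /= Gqp (negbTE pq) mul0r mulr0 subr0.
have : \sum_x expR m * (1 + (w x - m)) = (N%:R ^+ 2 - 2) * expR m + 2 * expR m * (1 - m).
  rewrite -mulr_sumr big_split /= sumrB !sumr_const card_prod card_ord Ew.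
  rewrite -[X in _ - X]mulr_natl natrM; ring.
rewrite (bigD1 (p, q)) // (bigD1 (q, p)) //= [leRHS](bigD1 (p, q)) // (bigD1 (q, p)) //=.
rewrite wpq wqp expR0 => h.
have le : \sum_(x | (x != (p, q)) && (x != (q, p))) expR m * (1 + (w x - m)) <=
    \sum_(x | (x != (p, q)) && (x != (q, p))) expR (w x).
  by apply: ler_sum => x _; exact: expR_tangent.
move: h le; rewrite sub0r.
set A := \sum_(x | _) _; set B := \sum_(x | _) _ => h le; nra.
Qed.
End GrassmannianEntries.

(** * Family-wise critical points *)

Section FamilywiseCritical.
Context {R : realType} {k : base_field} {N K : nat}.
Local Notation F := (scal_field R k).
Variables (G : 'M[F]_N) (hG : grassmannian K G).
Variables (I J T : set R) (eta : R).
Hypotheses (hI : open_interval I) (hJ : open_interval J) (hT : open_interval T).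
Hypotheses (hI0 : I `<=` [set x | 0 < x]) (hT0 : T `<=` [set x | 0 < x]).
Hypothesis hcrit : familywise_critical_point K (combined_potential K eta) I J T G.
Hypothesis offdiag : forall p q, p != q -> G p q != 0.
Hypothesis N2 : (2 <= N)%N.
Implicit Types (p q x j : 'I_N).

Lemma abs_gt0 p q : p != q -> 0 < scal_abs (G p q).
Proof.
move=> pq; rewrite lt_def scal_abs_ge0 andbT.
by apply: contra_neq (offdiag pq); exact: scal_abs_eq0.
Qed.

(** Two values of [delta] leave, after subtraction, only the contribution of the
    diagonal potential along the test curve for [p] and [q]. *)
Lemma diag_re_eq p q : scal_re (G p p) = scal_re (G q q).
Proof.
have [->//|pq] := eqVneq p q.
have [c [X [hc hX]]] := exists_diag_transfer_curve hG pq (offdiag pq).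
have [_ _ [al Ial]] := hI; have [_ _ [be Jbe]] := hJ.
have [d0 [d1 [d01 Td0 Td1]]] := open_interval_pair hT.
have a0 := lt0r_neq0 (hI0 Ial).
have E0 := critical_rate a0 (lt0r_neq0 (hT0 Td0)) (hcrit Ial Jbe Td0) hc.
have E1 := critical_rate a0 (lt0r_neq0 (hT0 Td1)) (hcrit Ial Jbe Td1) hc.
have Ed (e : R) : diag_rate e G X = 4 * scal_abs (G p q) *
   (scal_re (G p p) * expR (e * scal_re (G p p) ^+ 2) -
    scal_re (G q q) * expR (e * scal_re (G q q) ^+ 2)).
  rewrite /diag_rate (bigD1 p) //= (bigD1 q) 1?eq_sym //= big1; last first.
    move=> j /andP[jp jq]; rewrite /sqr_abs_rate hX (im_diag hG).
    by rewrite (negbTE jp) (negbTE jq) subrr; ring.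
  rewrite /sqr_abs_rate !hX !(sqr_abs_diag hG) !(im_diag hG) !eqxx (negbTE pq) [q == p]eq_sym.
  by rewrite (negbTE pq) /= ?mulr1n ?mulr0n; ring.
have g0 := abs_gt0 pq.
apply: (exp_gap_inj d01 (hT0 Td0)); rewrite ?(re_diag_ge0 hG) //.
apply: (mulfI (lt0r_neq0 g0)).
by move: E0 E1; rewrite !Ed; set e := 4; rewrite /e; lra.
Qed.

(** On the constant diagonal, [beta] enters the rate of the chain potential only
    through the term with factor [beta exp (u^2)]; two values of [beta] show that
    its coefficient, the sum in [cyclic_gap_eq0], vanishes. *)
Lemma row_exp_sums_eq (alpha : R) p q : I alpha ->
  \sum_j expR (alpha * scal_abs (G p j) ^+ 2) = \sum_j expR (alpha * scal_abs (G q j) ^+ 2).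
Proof.
move=> Ial; have a0 := lt0r_neq0 (hI0 Ial).
pose S x := alpha^-1 * \sum_(j < N | j != x) expR (alpha * scal_abs (G x j) ^+ 2).
pose u := scal_re (G p p).
have uE x : scal_re (G x x) = u by exact: diag_re_eq.
(* [u] is the squared norm of a row that has a nonzero off-diagonal entry. *)
have u0 : 0 < u.
  pose x0 : 'I_N := Ordinal (ltnW N2); pose x1 : 'I_N := Ordinal N2.
  rewrite -(uE x0) -(row_sqr_norm hG) (bigD1 x1) //= ltr_wpDr //.
    by apply: sumr_ge0 => l _; exact: sqr_ge0.
  by rewrite exprn_gt0 // abs_gt0.
have absE x : scal_abs (G x x) ^+ 2 = u ^+ 2 by rewrite (sqr_abs_diag hG) uE.
suff Sc x y : S x = S y.
  have E x : \sum_j expR (alpha * scal_abs (G x j) ^+ 2) = expR (alpha * u ^+ 2) + alpha * S x.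
    by rewrite (bigD1 x) //= absE /S mulVKf.
  by rewrite !E (Sc p q).
apply: ordS_const => {x y}; apply: cyclic_gap_eq0 => r s rs.
have [c [X [hc hX]]] := exists_diag_transfer_curve hG rs (offdiag rs).
have [_ _ [d Td]] := hT; have d0 := lt0r_neq0 (hT0 Td).
have [b0 [b1 [b01 Jb0 Jb1]]] := open_interval_pair hJ.
have E0 := critical_rate a0 d0 (hcrit Ial Jb0 Td) hc.
have E1 := critical_rate a0 d0 (hcrit Ial Jb1 Td) hc.
have g0 := abs_gt0 rs.
have rateE x : sqr_abs_rate G X x x =
    4 * scal_abs (G r s) * u * ((x == r)%:R - (x == s)%:R).
  by rewrite /sqr_abs_rate hX (im_diag hG) uE; ring.
have rowE (be : R) x y : exp_row_sum alpha be x G - exp_row_sum alpha be y G = S x - S y.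
  by rewrite /exp_row_sum !absE /S; ring.
have key : chain_rate alpha b1 G X - chain_rate alpha b0 G X =
    8 * scal_abs (G r s) * u * (b1 - b0) * expR (u ^+ 2) *
    \sum_x (S x - S (ordS x)) *
      (((x == r)%:R - (x == s)%:R) - ((ordS x == r)%:R - (ordS x == s)%:R)).
  rewrite /chain_rate -sumrB mulr_sumr; apply: eq_bigr => x _.
  by rewrite !rowE /row_sum_rate !absE !rateE; ring.
have : chain_rate alpha b1 G X - chain_rate alpha b0 G X = 0 by move: E0 E1; lra.
rewrite key => /eqP; rewrite mulf_eq0 => /orP[|/eqP //].
by rewrite gt_eqF // !mulr_gt0 // ?expR_gt0 ?subr_gt0.
Qed.

Lemma familywise_critical_equidistributed : equidistributed G.
Proof.
move=> p q; have [s hs] := exp_sums_perm hI (fun al => @row_exp_sums_eq al p q).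
exists s => j; rewrite (abs_sym hG) [RHS](abs_sym hG).
by apply/eqP; rewrite -(eqrXn2 (_ : 0 < 2)%N) ?scal_abs_ge0 //; apply/eqP; exact: hs.
Qed.
End FamilywiseCritical.

Theorem theorem4p24 (R : realType) (k : base_field) (N K : nat)
    (hN : (2 <= N)%N) (hK1 : (1 <= K)%N) (hKN : (K <= N)%N)
    (G : 'M[scal_field R k]_N) (hG : grassmannian K G)
    (I J T : set R)
    (hI : open_interval I) (hJ : open_interval J) (hT : open_interval T)
    (hI0 : I `<=` [set x | 0 < x]) (hJ0 : J `<=` [set x | 0 < x])
    (hT0 : T `<=` [set x | 0 < x])
    (eta : R) (heta : 0 < eta)
    (hcrit : familywise_critical_point K (combined_potential K eta) I J T G)
    (hbound : exists alpha' beta' delta' : R,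
      [/\ 0 < alpha', 0 < beta', 0 < delta' &
        combined_potential K eta alpha' beta' delta' G <
        2 + (N%:R ^+ 2 - 2) *
          expR (eta * (K%:R / (N%:R ^+ 2 - 2)
                       - K%:R ^+ 2 / (N%:R * (N%:R ^+ 2 - 2))
                       + K%:R * (N%:R - K%:R) /
                         (N%:R * (N%:R - 1) * (N%:R ^+ 2 - 2))))]) :
  equidistributed G.
Proof.
apply: (familywise_critical_equidistributed hG hI hJ hT hI0 hT0 hcrit) => // p q pq.
apply/eqP => Gpq; case: hbound => al [be [de [_ _ de0]]]; apply/negP; rewrite -leNgt.
apply: le_trans (sum_potential_ge hG eta hN hKN pq Gpq) _.
rewrite /combined_potential lerDr addr_ge0 ?chain_potential_ge0 //.
by rewrite diag_potential_ge0 // ltnW.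
Qed.
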